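(* Let $\mathfrak{N}$ be the inverse surface of the tangent developable surface $\mathfrak{M}(s,u)=\gamma(s)+uT(s)$ with respect to the inversion $\Phi=\Phi[c,r]$, and let $(\Gamma^{i}_{jk})_{\mathfrak{N}}$ be the Christoffel symbols of $\mathfrak{N}$. With $\lambda=\dfrac{r^2}{\|\mathfrak{M}-c\|^2}$ and $\kappa_s=\dfrac{d\kappa}{ds}$, the Christoffel symbols of $\mathfrak{N}$ are given by $$(\Gamma_{11}^{1})_{\mathfrak{N}}=\frac{u\kappa_s+\kappa}{u\kappa}+\frac{((u\kappa)^2-1)\frac{\partial\lambda^2}{\partial s}+((u\kappa)^2+1)\frac{\partial\lambda^2}{\partial u}}{2\lambda^2(u\kappa)^2},$$ $$(\Gamma_{11}^{2})_{\mathfrak{N}}=\frac{-\kappa(1+(u\kappa)^2)-u\kappa_s}{u\kappa}+\frac{((u\kappa)^2+1)\frac{\partial\lambda^2}{\partial s}+((u\kappa)^2+1)^2\frac{\partial\lambda^2}{\partial u}}{2\lambda^2(u\kappa)^2},$$ $$(\Gamma_{12}^{1})_{\mathfrak{N}}=\frac1u+\frac{((u\kappa)^2+1)\frac{\partial\lambda^2}{\partial u}-\frac{\partial\lambda^2}{\partial s}}{2\lambda^2(u\kappa)^2},$$ $$(\Gamma_{12}^{2})_{\mathfrak{N}}=-\frac1u+\frac{((u\kappa)^2+1)\left(\frac{\partial\lambda^2}{\partial s}-\frac{\partial\lambda^2}{\partial u}\right)}{2\lambda^2(u\kappa)^2},$$ $$(\Gamma_{22}^{1})_{\mathfrak{N}}=\frac{\frac{\partial\lambda^2}{\partial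 u}-\frac{\partial\lambda^2}{\partial s}}{2\lambda^2(u\kappa)^2},$$ $$(\Gamma_{22}^{2})_{\mathfrak{N}}=\frac{((u\kappa)^2-1)\frac{\partial\lambda^2}{\partial u}+\frac{\partial\lambda^2}{\partial s}}{2\lambda^2(u\kappa)^2}.$$
   Context: Let $c\in\mathbb{E}^3$ (Euclidean 3-space) and $r>0$. The inversion with center $c$ and radius $r$ (i.e. with respect to the sphere $S_c(r)$) is the map $\Phi[c,r]:\mathbb{E}^3\setminus\{c\}\to\mathbb{E}^3\setminus\{c\}$, $\Phi[c,r](p)=c+\frac{r^2}{\|p-c\|^2}(p-c)$. Let $\gamma:I\subset\mathbb{R}\to\mathbb{E}^3$ be a curve parametrized by arc length $s$, with Frenet frame $\{T,N,B\}$, curvature $\kappa$ and torsion $\tau$, so that $T'=\kappa N$, $N'=-\kappa T+\tau B$, $B'=-\tau N$. The tangent developable of $\gamma$ is the ruled surface $\mathfrak{M}(s,u)=\gamma(s)+uT(s)$, taken as a patch in $\mathbb{E}^3\setminus\{c\}$ and considered where $u\kappa(s)\neq0$. The inverse surface of $\mathfrak{M}$ with respect to $\Phi$ is $\mathfrak{N}=\Phi[c,r]\circ\mathfrak{M}=c+\frac{r^2}{\|\mathfrak{M}-c\|^2}(\mathfrak{M}-c)$, with parameters $(s,u)$. Christoffel symbols are those of the first fundamental form in the coordinates $(s,u)$, where index $1$ corresponds to $s$ and index $2$ to $u$; $\Gamma^i_{jk}$ has upper index $i$ and lower indices $j,k$.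
   Formalization: In the formula for Γ²₁₁ the sign before ((uκ)²+1)² ∂λ²/∂u is corrected from plus to minus; the printed plus sign is false wherever ∂λ²/∂u ≠ 0 (e.g. unit circle with c at its center, u = 1). *)

(* Defs.v *)
From mathcomp Require Import all_boot all_order all_algebra.
From mathcomp Require Import all_classical all_reals all_analysis.

Set Implicit Arguments.
Unset Strict Implicit.
Unset Printing Implicit Defensive.

Import Order.TTheory GRing.Theory Num.Theory.
Import numFieldNormedType.Exports.

Local Open Scope ring_scope.
Local Open Scope classical_set_scope.

(* Euclidean 3-space is 'rV[R]_3 with the inner product below. The library
   norm `|_| on row vectors is the sup norm; it induces the same topology, hence
   the same derivatives, but it is not the Euclidean norm [enorm]. *)
Definition dot (R : realType) (v w : 'rV[R]_3) : R :=
  \sum_(i < 3) v 0 i * w 0 i.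

Definition enorm (R : realType) (v : 'rV[R]_3) : R := Num.sqrt (dot v v).

(* The indices i + 1 and i + 2 are taken modulo 3. *)
Definition cross (R : realType) (v w : 'rV[R]_3) : 'rV[R]_3 :=
  \row_(i < 3) (v 0 (i + 1) * w 0 (i + 2%:R) - v 0 (i + 2%:R) * w 0 (i + 1)).

(* Meaningful for p != c only; the value at c is irrelevant. *)
Definition inversion (R : realType) (c : 'rV[R]_3) (r : R) (p : 'rV[R]_3) :
    'rV[R]_3 :=
  c + (r ^+ 2 / enorm (p - c) ^+ 2) *: (p - c).

(* Three derivatives are what is needed for the derivative of the curvature to
   exist; in particular every smooth curve is covered. The curvature is only
   required to be nonnegative, so that it is the norm of T'. *)
Record frenet_curve (R : realType) (I : set R) (gamma T N B : R -> 'rV[R]_3)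
    (kappa tau : R -> R) : Prop := FrenetCurve {
  frenet_open : open I;
  frenet_interval : is_interval I;
  frenet_diff : forall n s, (n < 3)%N -> I s -> derivable (gamma^`(n)) s 1;
  frenet_tangent : forall s, I s -> T s = gamma^`() s;
  frenet_TT : forall s, I s -> dot (T s) (T s) = 1;
  frenet_NN : forall s, I s -> dot (N s) (N s) = 1;
  frenet_TN : forall s, I s -> dot (T s) (N s) = 0;
  frenet_binormal : forall s, I s -> B s = cross (T s) (N s);
  frenet_kappa_ge0 : forall s, I s -> 0 <= kappa s;
  frenet_dT : forall s, I s -> is_derive s 1 T (kappa s *: N s);
  frenet_dN : forall s, I s ->
    is_derive s 1 N (- kappa s *: T s + tau s *: B s);
  frenet_dB : forall s, I s -> is_derive s 1 B (- tau s *: N s)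
}.

Definition tangent_developable (R : realType) (gamma T : R -> 'rV[R]_3)
    (s u : R) : 'rV[R]_3 :=
  gamma s + u *: T s.

Definition inverse_surface (R : realType) (c : 'rV[R]_3) (r : R)
    (X : R -> R -> 'rV[R]_3) (s u : R) : 'rV[R]_3 :=
  inversion c r (X s u).

Definition pd_s (R : realType) (V : normedModType R) (f : R -> R -> V)
    (s u : R) : V :=
  (fun x => f x u)^`() s.

Definition pd_u (R : realType) (V : normedModType R) (f : R -> R -> V)
    (s u : R) : V :=
  (fun y => f s y)^`() u.

(* 'I_2 = {0, 1} indexes the coordinates: 0 stands for s (classical index 1)
   and 1 stands for u (classical index 2). *)
Definition ix1 : 'I_2 := 0.
Definition ix2 : 'I_2 := 1.

Definition pd (R : realType) (V : normedModType R) (k : 'I_2)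
    (f : R -> R -> V) : R -> R -> V :=
  if k == ix1 then pd_s f else pd_u f.

Definition first_form (R : realType) (X : R -> R -> 'rV[R]_3) (s u : R) :
    'M[R]_2 :=
  \matrix_(i < 2, j < 2) dot (pd i X s u) (pd j X s u).

(* [christoffel X i j k] is the symbol with upper index i, lower indices j, k. *)
Definition christoffel (R : realType) (X : R -> R -> 'rV[R]_3)
    (i j k : 'I_2) (s u : R) : R :=
  let g a b : R -> R -> R := fun x y => first_form X x y a b in
  2^-1 * \sum_(l < 2) invmx (first_form X s u) i l *
    (pd j (g k l) s u + pd k (g j l) s u - pd l (g j k) s u).

(* The conformal factor of the inversion along the surface X. *)
Definition inversion_factor (R : realType) (c : 'rV[R]_3) (r : R)
    (X : R -> R -> 'rV[R]_3) (s u : R) : R :=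
  r ^+ 2 / enorm (X s u - c) ^+ 2.

(* Main.v *)
Require Import Defs.
From mathcomp Require Import all_boot all_order all_algebra.
From mathcomp Require Import all_classical all_reals all_analysis.
From mathcomp Require Import ring.
Import Order.TTheory GRing.Theory Num.Theory.
Import numFieldNormedType.Exports.
Local Open Scope ring_scope.
Local Open Scope classical_set_scope.

Set Implicit Arguments.
Unset Strict Implicit.
Unset Printing Implicit Defensive.

(** Inversion is conformal. Writing q for the position relative to the center
    and lambda = r^2 / |q|^2, the differential of the inversion is lambda times
    the reflection in the plane orthogonal to q, which is an isometry; so the
    first fundamental form of an inverse surface is lambda^2 times that of the
    original surface ([first_form_inverse_surface]).

    For the tangent developable, the partial derivatives are T + u kappa N and
    T, so the first fundamental form of the inverse surface is lambda^2 times
    the matrix with entries E = 1 + (u kappa)^2 and F = G = 1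
    ([first_form_inverse_developable]), of determinant
    lambda^4 (u kappa)^2. The six symbols then come from their classical
    expressions in E, F, G and the first derivatives of these
    ([christoffel_first_form]); only lambda^2 and E vary, and what remains is
    an identity between rational functions of u, kappa, kappa_s, lambda^2 and
    its two partial derivatives.

    Two analytic points need care. Differentiating the first fundamental form
    requires its expression on a neighbourhood of the point in each coordinate
    direction, hence that the surface avoids the center there
    ([is_derive_near_neq]). And the derivative of kappa must exist: it does
    because kappa = gamma'' . N ([derivable_curvature]). *)

(** * Derivatives of curves in coordinates *)

Lemma is_derive_derive1 {R : realType} {V : normedModType R} (f : R -> V)
    (x : R) (df : V) :
  is_derive x 1 f df -> f^`() x = df.
Proof. by move=> fx; rewrite derive1E derive_val. Qed.

Lemma derivable_is_derive1 {R : realType} {V : normedModType R} (f : R -> V)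
    (x : R) :
  derivable f x 1 -> is_derive x 1 f (f^`() x).
Proof. by move=> fx; rewrite derive1E; exact: derivableP. Qed.

Lemma is_derive_continuous {R : realType} {V : normedModType R} (f : R -> V)
    (x : R) (df : V) :
  is_derive x 1 f df -> {for x, continuous f}.
Proof.
by move=> [fx _]; apply/differentiable_continuous/derivable1_diffP.
Qed.

Lemma is_derive_near_neq {R : realType} n (f : R -> 'rV[R]_n) (x : R)
    (df c : 'rV[R]_n) :
  is_derive x 1 f df -> f x != c -> \forall y \near x, f y != c.
Proof.
move=> /is_derive_continuous fx fxc.
have fc0 : f y - c @[y --> x] --> f x - c by exact: cvgB fx (cvg_cst c).
have /(cvgr_neq0 _ fc0) : f x - c != 0 by rewrite subr_eq0.
by apply: filterS => y; rewrite subr_eq0.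
Qed.

Lemma is_derive_coord {R : realType} n (f : R -> 'rV[R]_n) (x : R)
    (df : 'rV[R]_n) (i : 'I_n) :
  is_derive x 1 f df -> is_derive x 1 (fun y => f y 0 i) (df 0 i).
Proof.
move=> [fD fE].
have dfi : h^-1 *: (((fun y => f y 0 i) \o shift x) (h *: 1) - f x 0 i)
    @[h --> 0^'] --> df 0 i.
  have -> : (fun h => h^-1 *: (((fun y => f y 0 i) \o shift x) (h *: 1) -
      f x 0 i)) = (fun N : 'rV[R]_n => N 0 i) \o
      (fun h => h^-1 *: ((f \o shift x) (h *: 1) - f x)).
    by apply/funext => h; rewrite /= !mxE.
  apply: continuous_cvg; first exact: coord_continuous.
  by rewrite -fE; exact: fD.
by apply: DeriveDef; [exact: cvgP dfi|exact: cvg_lim dfi].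
Qed.

(** The curve is the sum of its coordinates times the standard basis, which
    reduces its differentiability to that of real functions. *)
Lemma is_derive_rowP {R : realType} n (f : R -> 'rV[R]_n) (x : R)
    (df : 'rV[R]_n) :
  (forall i, is_derive x 1 (fun y => f y 0 i) (df 0 i)) -> is_derive x 1 f df.
Proof.
move=> fx; have fE : f = \sum_(i < n) (fun y => f y 0 i *: delta_mx 0 i).
  by apply/funext => y; rewrite fct_sumE; exact: row_sum_delta.
have fD : derivable f x 1.
  apply/derivable1_diffP; rewrite fE; apply: differentiable_sum => i.
  by apply: differentiableZl; apply/derivable1_diffP; case: (fx i).
apply: DeriveDef => //; apply/rowP => i.
have [_ <-] := fx i.
by have [_ ->] := is_derive_coord i (derivableP fD).
Qed.

Lemma is_derive_scale {R : realType} n (k : R -> R) (f : R -> 'rV[R]_n)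
    (x dk : R) (df : 'rV[R]_n) :
  is_derive x 1 k dk -> is_derive x 1 f df ->
  is_derive x 1 (fun y => k y *: f y) (k x *: df + dk *: f x).
Proof.
move=> kx fx; apply: is_derive_rowP => i.
have fix_ := is_derive_coord i fx.
under [X in is_derive _ _ X _]eq_fun do rewrite mxE.
by apply: is_derive_eq; rewrite !mxE /GRing.scale /= [f x 0 i * _]mulrC.
Qed.

Lemma is_derive_dot {R : realType} (f g : R -> 'rV[R]_3) (x : R)
    (df dg : 'rV[R]_3) :
  is_derive x 1 f df -> is_derive x 1 g dg ->
  is_derive x 1 (fun y => dot (f y) (g y)) (dot df (g x) + dot (f x) dg).
Proof.
move=> fx gx.
have fi i := is_derive_coord i fx.
have gi i := is_derive_coord i gx.
have -> : (fun y => dot (f y) (g y)) =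
    \sum_(i < 3) ((fun y => f y 0 i) * (fun y => g y 0 i)).
  by apply/funext => y; rewrite fct_sumE.
apply: is_derive_eq; rewrite /dot -big_split; apply: eq_bigr => i _ /=.
by rewrite /GRing.scale /= addrC [g x 0 i * _]mulrC.
Qed.

(** * The inner product and reflections *)

Section Dot.
Context {R : realType}.
Implicit Types v w z : 'rV[R]_3.

Lemma dotC v w : dot v w = dot w v.
Proof. by apply: eq_bigr => i _; rewrite mulrC. Qed.

Lemma dotDl v w z : dot (v + w) z = dot v z + dot w z.
Proof. by rewrite -big_split; apply: eq_bigr => i _; rewrite !mxE mulrDl. Qed.

Lemma dotZl a v w : dot (a *: v) w = a * dot v w.
Proof.
by rewrite /dot mulr_sumr; apply: eq_bigr => i _; rewrite !mxE mulrA.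
Qed.

Lemma dotDr v w z : dot v (w + z) = dot v w + dot v z.
Proof. by rewrite dotC dotDl !(dotC v). Qed.

Lemma dotZr a v w : dot v (a *: w) = a * dot v w.
Proof. by rewrite dotC dotZl dotC. Qed.

Lemma dotBl v w z : dot (v - w) z = dot v z - dot w z.
Proof. by rewrite -scaleN1r dotDl dotZl mulN1r. Qed.

Lemma dotBr v w z : dot v (w - z) = dot v w - dot v z.
Proof. by rewrite dotC dotBl !(dotC v). Qed.

Lemma dot_ge0 v : 0 <= dot v v.
Proof. by apply: sumr_ge0 => i _; rewrite -expr2 sqr_ge0. Qed.

Lemma dot_eq0 v : (dot v v == 0) = (v == 0).
Proof.
apply/eqP/eqP => [v0|->]; last first.
  by rewrite /dot big1 // => i _; rewrite mxE mul0r.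
apply/rowP => i; rewrite mxE.
have /allP/(_ i) : all (fun i => (predT i) ==> (v 0 i * v 0 i == 0))
    (index_enum 'I_3).
  by rewrite -psumr_eq0 ?[X in X == _]v0 // => j _; rewrite -expr2 sqr_ge0.
by rewrite mem_index_enum -expr2 sqrf_eq0 => /(_ isT)/eqP.
Qed.

Lemma enorm_sqr v : enorm v ^+ 2 = dot v v.
Proof. by rewrite /enorm sqr_sqrtr ?dot_ge0. Qed.

(** The reflection in the plane orthogonal to [q]. *)
Definition reflect_along q v := v - (2 * dot q v / dot q q) *: q.

Lemma dot_reflect_along q v w :
  q != 0 -> dot (reflect_along q v) (reflect_along q w) = dot v w.
Proof.
rewrite -dot_eq0 => q0; rewrite /reflect_along.
by rewrite dotBl !dotBr !dotZl !dotZr (dotC v q); field.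
Qed.

End Dot.

(** * Conformality of the inversion *)

Section Inversion.
Context {R : realType} (c : 'rV[R]_3) (r : R).
Variables (p : R -> 'rV[R]_3) (x : R) (dp : 'rV[R]_3).
Hypotheses (pxc : p x != c) (px : is_derive x 1 p dp).

Let q y := p y - c.
Let factor y := r ^+ 2 / enorm (q y) ^+ 2.

Let qx : is_derive x 1 q dp.
Proof. by rewrite -[dp]subr0; apply: is_deriveB. Qed.

Lemma is_derive_inversion_factor :
  is_derive x 1 factor (- (2 * dot (q x) dp / dot (q x) (q x)) * factor x).
Proof.
have q0 : dot (q x) (q x) != 0 by rewrite dot_eq0 subr_eq0.
have := is_deriveZ (r ^+ 2) (is_deriveV q0 (is_derive_dot qx qx)).
rewrite (_ : _ \*: _ = factor); last first.
  by apply/funext => y; rewrite /factor enorm_sqr.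
move=> /is_derive_eq; apply.
by rewrite /factor enorm_sqr (dotC dp) /GRing.scale /=; field.
Qed.

(** The factor has logarithmic derivative - 2 (q . dp) / |q|^2, twice what would
    cancel the radial part of the velocity, which is therefore reversed. *)
Lemma is_derive_inversion :
  is_derive x 1 (fun y => inversion c r (p y))
    (factor x *: reflect_along (q x) dp).
Proof.
have := is_deriveD (is_derive_cst c x 1)
  (is_derive_scale is_derive_inversion_factor qx).
rewrite add0r => /is_derive_eq; apply.
by rewrite /reflect_along [RHS]scalerBr [in RHS]scalerA mulNr scaleNr
  [factor x * _]mulrC.
Qed.

End Inversion.


(** Both partial velocities are reflected along the same vector and scaled by
    the same factor, so their inner products are scaled by its square. *)
Lemma first_form_inverse_surface {R : realType} (c : 'rV[R]_3) (r : R)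
    (X : R -> R -> 'rV[R]_3) (s u : R) (Xs Xu : 'rV[R]_3) :
  X s u != c ->
  is_derive s 1 (X^~ u) Xs -> is_derive u 1 (X s) Xu ->
  let d (i : 'I_2) := if i == ix1 then Xs else Xu in
  first_form (inverse_surface c r X) s u =
    \matrix_(i < 2, j < 2) (inversion_factor c r X s u ^+ 2 * dot (d i) (d j)).
Proof.
move=> Xc Xs_ Xu_ d.
have pdE i : pd i (inverse_surface c r X) s u =
    inversion_factor c r X s u *: reflect_along (X s u - c) (d i).
  rewrite /pd /d; case: (i == ix1); apply: is_derive_derive1.
    exact: (@is_derive_inversion R c r (X^~ u) s Xs Xc Xs_).
  exact: (@is_derive_inversion R c r (X s) u Xu Xc Xu_).
apply/matrixP => i j; rewrite !mxE !pdE dotZl dotZr dot_reflect_along.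
  by rewrite mulrA -expr2.
by rewrite subr_eq0.
Qed.

(** * Christoffel symbols in terms of E, F and G *)

Lemma invmx_mx22 {F : fieldType} (A : 'M[F]_2) :
  let D := A 0 0 * A 1 1 - A 0 1 * A 1 0 in
  D != 0 ->
  [/\ invmx A 0 0 = A 1 1 / D, invmx A 0 1 = - A 0 1 / D,
      invmx A 1 0 = - A 1 0 / D & invmx A 1 1 = A 0 0 / D].
Proof.
move=> D D0.
(* The adjugate over the determinant; in 'I_2, 1 - i is the other index. *)
pose B : 'M[F]_2 := \matrix_(i, j)
  ((if i == j then A (1 - i) (1 - j) else - A i j) / D).
have AB : A *m B = 1%:M.
  apply/matrixP => i j; rewrite !mxE !big_ord_recl big_ord0 !mxE.
  have -> : lift ord0 ord0 = 1 :> 'I_2 by exact: val_inj.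
  have -> : ord0 = 0 :> 'I_2 by [].
  have i01 (k : 'I_2) : k = 0 \/ k = 1.
    by case: k => [[|[|//]] ?]; [left|right]; exact: val_inj.
  have e0 : 1 - 0 = 1 :> 'I_2 by exact: val_inj.
  have e1 : 1 - 1 = 0 :> 'I_2 by exact: val_inj.
  by case: (i01 i) (i01 j) => -> [] ->; rewrite /= ?e0 ?e1 /= /D;
    rewrite /D in D0; field.
have [Au _] := mulmx1_unit AB.
have -> : invmx A = B by rewrite -[RHS](mulKmx Au) AB mulmx1.
have e0 : 1 - 0 = 1 :> 'I_2 by exact: val_inj.
have e1 : 1 - 1 = 0 :> 'I_2 by exact: val_inj.
by rewrite !mxE /= ?e0 ?e1.
Qed.

Lemma first_form_sym {R : realType} (X : R -> R -> 'rV[R]_3) (s u : R)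
    (i j : 'I_2) :
  first_form X s u i j = first_form X s u j i.
Proof. by rewrite !mxE dotC. Qed.

Lemma christoffel_first_form {R : realType} (X : R -> R -> 'rV[R]_3) (s u : R) :
  let g i j x y := first_form X x y i j in
  let E := g ix1 ix1 in let F := g ix1 ix2 in let G := g ix2 ix2 in
  let D := E s u * G s u - F s u ^+ 2 in
  let Es := pd_s E s u in let Eu := pd_u E s u in
  let Fs := pd_s F s u in let Fu := pd_u F s u in
  let Gs := pd_s G s u in let Gu := pd_u G s u in
  D != 0 ->
  [/\ christoffel X ix1 ix1 ix1 s u =
        (G s u * Es - F s u * (2 * Fs - Eu)) / (2 * D),
      christoffel X ix2 ix1 ix1 s u =
        (E s u * (2 * Fs - Eu) - F s u * Es) / (2 * D) &
      christoffel X ix1 ix1 ix2 s u = (G s u * Eu - F s u * Gs) / (2 * D)] /\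
  [/\ christoffel X ix2 ix1 ix2 s u = (E s u * Gs - F s u * Eu) / (2 * D),
      christoffel X ix1 ix2 ix2 s u =
        (G s u * (2 * Fu - Gs) - F s u * Gu) / (2 * D) &
      christoffel X ix2 ix2 ix2 s u =
        (E s u * Gu - F s u * (2 * Fu - Gs)) / (2 * D)].
Proof.
move=> g E F G D Es Eu Fs Fu Gs Gu D0.
have gF : g ix2 ix1 = F.
  by apply/funext => x; apply/funext => y; exact: first_form_sym.
have DE : D = first_form X s u 0 0 * first_form X s u 1 1 -
    first_form X s u 0 1 * first_form X s u 1 0.
  by rewrite [X in _ - _ * X]first_form_sym.
have [] := @invmx_mx22 _ (first_form X s u).
  by rewrite -DE.
rewrite -DE [first_form X s u 1 0]first_form_sym.
rewrite -[first_form X s u 0 0]/(E s u) -[first_form X s u 0 1]/(F s u).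
rewrite -[first_form X s u 1 1]/(G s u) => i00 i01 i10 i11.
have o1 : lift ord0 ord0 = 1 :> 'I_2 by exact: val_inj.
have sumE (h : 'I_2 -> R) : \sum_(l < 2) h l = h 0 + h 1.
  by rewrite !big_ord_recl big_ord0 addr0 o1.
rewrite /christoffel !sumE /pd /ix1 /ix2 /= i00 i01 i10 i11.
rewrite -/(g 0 0) -/(g 0 1) -/(g 1 0) -/(g 1 1) gF -/E -/F -/G.
rewrite -/Es -/Eu -/Fs -/Fu -/Gs -/Gu.
by split; split; field.
Qed.

(** * The tangent developable and its inverse *)

Section TangentDevelopable.
Context {R : realType} (I : set R) (gamma T N B : R -> 'rV[R]_3)
  (kappa tau : R -> R).
Hypothesis hgamma : frenet_curve I gamma T N B kappa tau.
Let M := tangent_developable gamma T.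

Lemma is_derive_curve s : I s -> is_derive s 1 gamma (T s).
Proof.
move=> Is; rewrite (frenet_tangent hgamma Is).
exact/derivable_is_derive1/(@frenet_diff _ _ _ _ _ _ _ _ hgamma 0).
Qed.

Lemma is_derive_developable_s s u :
  I s -> is_derive s 1 (M^~ u) (T s + (u * kappa s) *: N s).
Proof.
move=> Is; rewrite -scalerA.
exact: is_deriveD (is_derive_curve Is) (is_deriveZ u (frenet_dT hgamma Is)).
Qed.

Lemma is_derive_developable_u (s u : R) : is_derive u 1 (M s) (T s).
Proof.
have := is_deriveD (is_derive_cst (gamma s) u 1)
  (is_derive_scale (is_derive_id u 1) (is_derive_cst (T s) u 1)).
by rewrite scaler0 !add0r scale1r.
Qed.

(** Near [s], T' = kappa N gives gamma'' = kappa N, so kappa is the inner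
    product of the differentiable curves gamma'' and N. *)
Lemma derivable_curvature s : I s -> derivable kappa s 1.
Proof.
move=> Is.
have nI : \forall x \near s, I x.
  exact: open_nbhs_nbhs (conj (frenet_open hgamma) Is).
have d2 := derivable_is_derive1
  (@frenet_diff _ _ _ _ _ _ _ _ hgamma 2 s isT Is).
have [kD _] := is_derive_dot d2 (frenet_dN hgamma Is).
apply: near_eq_derivable kD; near=> x.
have Ix : I x by near: x.
have -> : gamma^`(2) x = kappa x *: N x.
  rewrite derive1nS derive1n1 -(is_derive_derive1 (frenet_dT hgamma Ix)).
  rewrite !derive1E; apply: near_eq_derive; near=> y.
  apply/esym/(frenet_tangent hgamma); near: y.
  exact: open_nbhs_nbhs (conj (frenet_open hgamma) Ix).
by rewrite dotZl (frenet_NN hgamma Ix) mulr1.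
Unshelve. all: by end_near. Qed.

Lemma first_form_inverse_developable (c : 'rV[R]_3) (r s u : R) (i j : 'I_2) :
  I s -> M s u != c ->
  first_form (inverse_surface c r M) s u i j =
    inversion_factor c r M s u ^+ 2 *
    (if (i == ix1) && (j == ix1) then 1 + (u * kappa s) ^+ 2 else 1).
Proof.
move=> Is Mc.
rewrite (first_form_inverse_surface r Mc (is_derive_developable_s u Is)
  (is_derive_developable_u s u)) mxE.
have TT := frenet_TT hgamma Is; have NN := frenet_NN hgamma Is.
have TN := frenet_TN hgamma Is; have NT := TN; rewrite dotC in NT.
congr (_ * _); case: (i == ix1); case: (j == ix1) => /=;
  by rewrite ?dotDl ?dotDr ?dotZl ?dotZr ?TT ?NN ?TN ?NT; ring.
Qed.

End TangentDevelopable.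

Theorem theorem4p2 (R : realType) (c : 'rV[R]_3) (r : R) (hr : 0 < r)
    (I : set R) (gamma T N B : R -> 'rV[R]_3) (kappa tau : R -> R)
    (hgamma : frenet_curve I gamma T N B kappa tau)
    (s u : R) (hs : I s)
    (hc : tangent_developable gamma T s u <> c)
    (huk : u * kappa s <> 0) :
  let M := tangent_developable gamma T in
  let NN := inverse_surface c r M in
  let lambda := inversion_factor c r M in
  let lambda2 : R -> R -> R := fun x y => lambda x y ^+ 2 in
  let l2 := lambda2 s u in
  let l2_s := pd_s lambda2 s u in
  let l2_u := pd_u lambda2 s u in
  let k := kappa s in
  let k_s := kappa^`() s in
  (christoffel NN ix1 ix1 ix1 s u =
        (u * k_s + k) / (u * k) +
        (((u * k) ^+ 2 - 1) * l2_s + ((u * k) ^+ 2 + 1) * l2_u)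
          / (2 * l2 * (u * k) ^+ 2)) /\
  (christoffel NN ix2 ix1 ix1 s u =
        (- k * (1 + (u * k) ^+ 2) - u * k_s) / (u * k) +
        (((u * k) ^+ 2 + 1) * l2_s - ((u * k) ^+ 2 + 1) ^+ 2 * l2_u)
          / (2 * l2 * (u * k) ^+ 2)) /\
  (christoffel NN ix1 ix1 ix2 s u =
        1 / u +
        (((u * k) ^+ 2 + 1) * l2_u - l2_s) / (2 * l2 * (u * k) ^+ 2)) /\
  (christoffel NN ix2 ix1 ix2 s u =
        - (1 / u) +
        (((u * k) ^+ 2 + 1) * (l2_s - l2_u)) / (2 * l2 * (u * k) ^+ 2)) /\
  (christoffel NN ix1 ix2 ix2 s u =
        (l2_u - l2_s) / (2 * l2 * (u * k) ^+ 2)) /\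
  (christoffel NN ix2 ix2 ix2 s u =
        (((u * k) ^+ 2 - 1) * l2_u + l2_s) / (2 * l2 * (u * k) ^+ 2)).
Proof.
move=> M NN lambda lambda2 l2 l2_s l2_u k k_s.
have Mc : M s u != c by apply/eqP.
have Ms x y (Ix : I x) := is_derive_developable_s hgamma y Ix.
have Mu (x y : R) : is_derive y 1 (M x) (T x) :=
  is_derive_developable_u gamma T x y.
have ks : is_derive s 1 kappa k_s.
  exact/derivable_is_derive1/(derivable_curvature hgamma hs).
have sqrE (f : R -> R) : (fun x => f x ^+ 2) = f ^+ 2.
  by apply/funext => x; rewrite !expr2.
have ls : is_derive s 1 (fun x => lambda2 x u) l2_s.
  apply: derivable_is_derive1.
  have [lD _] := @is_derive_inversion_factor R c r (M^~ u) s _ Mc (Ms s u hs).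
  by rewrite /lambda2 (sqrE (lambda^~ u)); apply: derivableX; exact: lD.
have lu : is_derive u 1 (lambda2 s) l2_u.
  apply: derivable_is_derive1.
  have [lD _] := @is_derive_inversion_factor R c r (M s) u _ Mc (Mu s u).
  by rewrite /lambda2 (sqrE (lambda s)); apply: derivableX; exact: lD.
(* The first fundamental form of the tangent developable itself. *)
pose m (i j : 'I_2) x y : R :=
  if (i == ix1) && (j == ix1) then 1 + (y * kappa x) ^+ 2 else 1.
have near_s : \forall x \near s, I x /\ M x u != c.
  near=> x; split; near: x; last first.
    exact: (@is_derive_near_neq R 3 (M^~ u) s _ c (Ms s u hs) Mc).
  exact: open_nbhs_nbhs (conj (frenet_open hgamma) hs).
have near_u : \forall y \near u, M s y != c.
  exact: @is_derive_near_neq R 3 (M s) u _ c (Mu s u) Mc.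
(* Products are differentiated along a coordinate line, where the first
   fundamental form agrees with l2 * m only near the point. *)
have g_s i j ms : is_derive s 1 (fun x => m i j x u) ms ->
    pd_s (fun x y => first_form NN x y i j) s u = l2 * ms + m i j s u * l2_s.
  move=> mD; apply: is_derive_derive1.
  apply: near_eq_is_derive (is_deriveM ls mD).
  near=> x; have [Ix Mxc] : I x /\ M x u != c by near: x.
  by rewrite (first_form_inverse_developable hgamma r i j Ix Mxc).
have g_u i j mu : is_derive u 1 (m i j s) mu ->
    pd_u (fun x y => first_form NN x y i j) s u = l2 * mu + m i j s u * l2_u.
  move=> mD; apply: is_derive_derive1.
  apply: near_eq_is_derive (is_deriveM lu mD).
  near=> y; have Myc : M s y != c by near: y.
  by rewrite (first_form_inverse_developable hgamma r i j hs Myc).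
have gE i j : first_form NN s u i j = l2 * m i j s u.
  exact: (first_form_inverse_developable hgamma r i j hs Mc).
have m11s : is_derive s 1 (fun x => m ix1 ix1 x u) (2 * u ^+ 2 * k * k_s).
  have := is_deriveD (is_derive_cst (1 : R) s 1)
    (is_deriveX 2 (is_deriveZ u ks)).
  rewrite -sqrE => /is_derive_eq; apply.
  by rewrite /= /GRing.scale /= -/k; ring.
have m11u : is_derive u 1 (m ix1 ix1 s) (2 * u * k ^+ 2).
  have := is_deriveD (is_derive_cst (1 : R) u 1)
    (is_deriveX 2 (is_deriveM (is_derive_id u 1) (is_derive_cst k u 1))).
  rewrite -sqrE => /is_derive_eq; apply.
  by rewrite mulrfctE /= /GRing.scale /=; ring.
have m12s := is_derive_cst (1 : R) s 1.
have m12u := is_derive_cst (1 : R) u 1.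
have u0 : u != 0 by apply: contra_notN huk => /eqP ->; rewrite mul0r.
have k0 : k != 0.
  by apply: contra_notN huk => /eqP; rewrite -/k => ->; rewrite mulr0.
have l0 : lambda s u != 0.
  have M0 : dot (M s u - c) (M s u - c) != 0 by rewrite dot_eq0 subr_eq0.
  by rewrite /lambda /inversion_factor enorm_sqr mulf_neq0 ?invr_neq0 //
    expf_neq0 // gt_eqF.
have L0 : l2 != 0 by exact: expf_neq0.
have DE : l2 * (1 + (u * k) ^+ 2) * (l2 * 1) - (l2 * 1) ^+ 2 =
    (l2 * (u * k)) ^+ 2 by ring.
have [] := @christoffel_first_form R NN s u.
  by rewrite !gE /m /= -/k DE expf_neq0 // (mulf_neq0 L0) // mulf_neq0.
rewrite !gE (g_s _ _ _ m11s) (g_u _ _ _ m11u).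
rewrite (g_s ix1 ix2 _ m12s) (g_u ix1 ix2 _ m12u).
rewrite (g_s ix2 ix2 _ m12s) (g_u ix2 ix2 _ m12u).
rewrite /m /= -/k DE => - [-> -> ->] [-> -> ->].
(* From here on these are independent variables of a rational identity. *)
clearbody l2 l2_s l2_u k k_s.
by do !split; field; rewrite u0 k0 L0.
Unshelve. all: by end_near. Qed.
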